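(* For $n=3$ or $4$ the commutator subgroup $A_{H_n}'$ of the Artin group $A_{H_n}$ is the group generated by $$p_k=a_1^ka_2a_1^{-(k+1)}\ (k\in\mathbb{Z}),\qquad q_\ell=a_\ell a_1^{-1}\ (3\le\ell\le n),$$ with defining relations $$p_kq_j=q_jp_{k+1}\ (4\le j\le n,\ k\in\mathbb{Z}),$$ $$p_{k+1}p_{k+3}p_{k+4}^{-1}p_{k+2}^{-1}p_k^{-1}=1\ (k\in\mathbb{Z}),$$ $$p_kq_3p_{k+2}q_3^{-1}p_{k+1}^{-1}q_3^{-1}=1\ (k\in\mathbb{Z}),$$ $$q_iq_{i+1}q_i=q_{i+1}q_iq_{i+1}\ (3\le i\le n-1).$$
   Context: $A_{H_n}$ ($n=3,4$) is the Artin group of type $H_n$: generators $a_1,\dots,a_n$ and relations $a_ia_j=a_ja_i$ for $|i-j|\ge2$, $a_1a_2a_1a_2a_1=a_2a_1a_2a_1a_2$, $a_ia_{i+1}a_i=a_{i+1}a_ia_{i+1}$ for $2\le i\le n-1$. $G'$ denotes the commutator subgroup of $G$. ''Generated by the listed elements with the listed defining relations'' means that the listed elements lie in $A_{H_n}'$ and that the obvious map from the abstract group with that presentation to $A_{H_n}'$ is an isomorphism. *)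

(* Defs.v *)
From HB Require Import structures.
From mathcomp Require Import all_boot all_order all_algebra.
From mathcomp Require Import boolp.

Set Implicit Arguments.
Unset Strict Implicit.
Unset Printing Implicit Defensive.

Import GRing.Theory.
Local Open Scope quotient_scope.

(* The letter (x, true) stands for x, and (x, false) for x^-1. *)
Definition word (X : Type) : Type := seq (X * bool).
HB.instance Definition _ (X : choiceType) := Choice.on (word X).

Definition pos (X : Type) (x : X) : X * bool := (x, true).
Definition neg (X : Type) (x : X) : X * bool := (x, false).

Definition winv (X : Type) (w : word X) : word X :=
  rev [seq (c.1, ~~ c.2) | c <- w].

Section PresentedGroup.

(* R u v means that u = v is one of the defining relations. *)
Variables (X : choiceType) (R : word X -> word X -> Prop).

Inductive wcong : word X -> word X -> Prop :=
| wcong_refl u : wcong u u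
| wcong_sym u v : wcong u v -> wcong v u
| wcong_trans u v w : wcong u v -> wcong v w -> wcong u w
| wcong_cat u u' v v' : wcong u u' -> wcong v v' -> wcong (u ++ v) (u' ++ v')
| wcong_cancel x b : wcong [:: (x, b); (x, ~~ b)] [::]
| wcong_rel u v : R u v -> wcong u v.

Definition wcongb : rel (word X) := fun u v => `[< wcong u v >].

Fact wcongb_refl : reflexive wcongb.
Proof. by move=> u; apply/asboolP/wcong_refl. Qed.

Fact wcongb_sym : symmetric wcongb.
Proof.
by move=> u v; apply/idP/idP => /asboolP h; apply/asboolP/wcong_sym.
Qed.

Fact wcongb_trans : transitive wcongb.
Proof.
by move=> v u w /asboolP uv /asboolP vw; apply/asboolP/(wcong_trans uv vw).
Qed.

Canonical wcong_equiv := EquivRel wcongb wcongb_refl wcongb_sym wcongb_trans.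

Definition presented : Type := {eq_quot wcong_equiv}.
HB.instance Definition _ := Choice.on presented.

Definition pi_word (w : word X) : presented := \pi_({eq_quot wcong_equiv}) w.
Definition repr_word (g : presented) : word X :=
  repr (g : {eq_quot wcong_equiv}).

Lemma repr_wordK : cancel repr_word pi_word.
Proof. by move=> g; rewrite /pi_word /repr_word reprK. Qed.

Lemma pi_wordP u v : pi_word u = pi_word v <-> wcong u v.
Proof.
split=> [/eqP|h]; first by rewrite /pi_word piE => /asboolP.
by apply/eqP; rewrite /pi_word piE; apply/asboolP.
Qed.

Lemma repr_pi_word w : wcong (repr_word (pi_word w)) w.
Proof. by apply/pi_wordP; rewrite repr_wordK. Qed.

Lemma winv_cons (c : X * bool) (w : word X) :
  winv (c :: w) = winv w ++ [:: (c.1, ~~ c.2)].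
Proof. by rewrite /winv /= rev_cons -cats1. Qed.

Lemma winv_cat (u v : word X) : winv (u ++ v) = winv v ++ winv u.
Proof. by rewrite /winv map_cat rev_cat. Qed.

Lemma winvK : involutive (@winv X).
Proof.
move=> w; rewrite /winv map_rev revK -map_comp -[RHS]map_id.
by apply: eq_map => -[x b] /=; rewrite negbK.
Qed.

Lemma wcong_mulV w : wcong (w ++ winv w) [::].
Proof.
elim: w => [|[x b] w IHw]; first exact: wcong_refl.
rewrite winv_cons /=.
apply: (wcong_trans _ (wcong_cancel x b)).
rewrite -[_ :: _]/([:: (x, b)] ++ _) -[[:: _; _]]/([:: (x, b)] ++ _).
apply: wcong_cat; first exact: wcong_refl.
rewrite catA -[[:: _] in X in wcong _ X]/([::] ++ _).
by apply: wcong_cat => //; apply: wcong_refl.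
Qed.

Lemma wcong_winv u v : wcong u v -> wcong (winv u) (winv v).
Proof.
move=> uv; have e1 : wcong (winv u) (winv u ++ (v ++ winv v)).
  rewrite -[X in wcong X _]cats0.
  by apply: wcong_cat; [apply: wcong_refl | apply/wcong_sym/wcong_mulV].
apply: (wcong_trans e1); rewrite catA -[X in wcong _ X]cat0s.
apply: wcong_cat; last exact: wcong_refl.
apply: (@wcong_trans _ (winv u ++ u)).
  by apply: wcong_cat; [apply: wcong_refl | apply: wcong_sym].
by rewrite -{2}[u]winvK; apply: wcong_mulV.
Qed.

Definition pmul (g h : presented) : presented :=
  pi_word (repr_word g ++ repr_word h).
Definition pone : presented := pi_word [::].
Definition pinv (g : presented) : presented := pi_word (winv (repr_word g)).

Lemma pmulE u v : pmul (pi_word u) (pi_word v) = pi_word (u ++ v).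
Proof. by apply/pi_wordP/wcong_cat; apply: repr_pi_word. Qed.

Lemma pinvE u : pinv (pi_word u) = pi_word (winv u).
Proof. by apply/pi_wordP/wcong_winv/repr_pi_word. Qed.

Fact pmulA : associative pmul.
Proof.
move=> g h k; rewrite -[g]repr_wordK -[h]repr_wordK -[k]repr_wordK.
by rewrite !pmulE catA.
Qed.

Fact pmul1g : left_id pone pmul.
Proof. by move=> g; rewrite -[g]repr_wordK pmulE. Qed.

Fact pmulg1 : right_id pone pmul.
Proof. by move=> g; rewrite -[g]repr_wordK pmulE cats0. Qed.

Fact pmulgV : right_inverse pone pinv pmul.
Proof.
move=> g; rewrite -[g]repr_wordK pinvE pmulE.
exact/pi_wordP/wcong_mulV.
Qed.

Fact pmulVg : left_inverse pone pinv pmul.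
Proof.
move=> g; rewrite -[g]repr_wordK pinvE pmulE; apply/pi_wordP.
by rewrite -{2}[repr_word g]winvK; apply: wcong_mulV.
Qed.

HB.instance Definition _ :=
  isGroup.Build presented pmulA pmul1g pmulg1 pmulVg pmulgV.

Definition pgen (x : X) : presented := pi_word [:: pos x].

End PresentedGroup.

Arguments pgen {X} R x.

Local Open Scope group_scope.

Section CommutatorSubgroup.

Variable G : groupType.

Definition commutator_pred : {pred G} := fun x =>
  `[< forall S : {pred G}, group_closed S ->
        (forall y z : G, [~ y, z] \in S) -> x \in S >].

Fact commutator_pred_closed : group_closed commutator_pred.
Proof.
split=> [|x y /asboolP hx /asboolP hy]; apply/asboolP => S clS hS.
  exact: (fst clS).
by apply: (snd clS); [apply: hx | apply: hy].
Qed.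

Record commutator_group : Type := CommutatorGroup {
  commutator_val : G;
  _ : commutator_val \in commutator_pred
}.
HB.instance Definition _ := [isSub for commutator_val].
HB.instance Definition _ := [Choice of commutator_group by <:].
HB.instance Definition _ :=
  SubChoice_isSubGroup.Build G commutator_pred commutator_group
    commutator_pred_closed.

End CommutatorSubgroup.

Arguments commutator_pred : clear implicits.

Definition expgz (G : groupType) (x : G) (k : int) : G :=
  match k with Posz m => x ^+ m | Negz m => x ^- m.+1 end.

Notation idx m n := {i : nat | (m <= i <= n)%N}.

Section ArtinH.

Variable n : nat.

Inductive artinH_rel :
  word (idx 1 n) -> word (idx 1 n) -> Prop :=
| artinH_commute (i j : idx 1 n) :
    (val i + 2 <= val j)%N || (val j + 2 <= val i)%N ->
    artinH_rel [:: pos i; pos j] [:: pos j; pos i]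
| artinH_penta (i j : idx 1 n) : val i = 1%N -> val j = 2%N ->
    artinH_rel [:: pos i; pos j; pos i; pos j; pos i]
               [:: pos j; pos i; pos j; pos i; pos j]
| artinH_braid (i j : idx 1 n) : (2 <= val i)%N -> val j = (val i).+1 ->
    artinH_rel [:: pos i; pos j; pos i] [:: pos j; pos i; pos j].

Definition artinH : groupType := presented artinH_rel.

(* The generator a_i, with the junk value 1 unless 1 <= i <= n. *)
Definition artin_gen (i : nat) : artinH :=
  if insub i is Some j then pgen artinH_rel j else 1.

Definition p_elt (k : int) : artinH :=
  expgz (artin_gen 1) k * artin_gen 2 * expgz (artin_gen 1) (- (k + 1))%R.

Definition q_elt (l : nat) : artinH := artin_gen l * (artin_gen 1)^-1.

(* The abstract generators: inl k stands for p_k, inr l for q_l. *)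
Definition pqgen : choiceType := (int + idx 3 n)%type.

Definition p_gen (k : int) : pqgen := inl k.
Definition q_gen (l : idx 3 n) : pqgen := inr l.

Inductive pq_rel : word pqgen -> word pqgen -> Prop :=
| pq_rel_shift (k : int) (j : idx 3 n) : (4 <= val j)%N ->
    pq_rel [:: pos (p_gen k); pos (q_gen j)]
           [:: pos (q_gen j); pos (p_gen (k + 1)%R)]
| pq_rel_penta (k : int) :
    pq_rel [:: pos (p_gen (k + 1)%R); pos (p_gen (k + 3)%R);
               neg (p_gen (k + 4)%R); neg (p_gen (k + 2)%R); neg (p_gen k)] [::]
| pq_rel_q3 (k : int) (l : idx 3 n) : val l = 3%N ->
    pq_rel [:: pos (p_gen k); pos (q_gen l); pos (p_gen (k + 2)%R);
               neg (q_gen l); neg (p_gen (k + 1)%R); neg (q_gen l)] [::]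
| pq_rel_braid (i j : idx 3 n) : val j = (val i).+1 ->
    pq_rel [:: pos (q_gen i); pos (q_gen j); pos (q_gen i)]
           [:: pos (q_gen j); pos (q_gen i); pos (q_gen j)].

Definition pq_group : groupType := presented pq_rel.

End ArtinH.

(* Main.v *)
(** Killing all [a_i a_1^-1] maps A_{H_n} onto Z with kernel A_{H_n}'.  Writing
    t = a_1, the presented group K on the p_k and q_l carries the automorphism
    p_k |-> p_{k+1}, q_l |-> q_l, hence a semidirect product K x| Z.  The map
    a_1 |-> (1, 1), a_2 |-> (p_0, 1), a_l |-> (q_l, 1) and the map
    (x, m) |-> x t^m are mutually inverse morphisms between A_{H_n} and
    K x| Z, and elements of A_{H_n}' are exactly those with Z-component 0. *)

From HB Require Import structures.
Require Import Defs.
From mathcomp Require Import all_boot all_order all_algebra.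
From mathcomp Require Import boolp.

Set Implicit Arguments.
Unset Strict Implicit.
Unset Printing Implicit Defensive.

Import GRing.Theory.
Local Open Scope group_scope.

(** * Laws of integer powers *)

Section IntegerPowers.

Variables (G : groupType) (x : G).

Lemma expgzS (k : int) : expgz x (k + 1)%R = expgz x k * x.
Proof.
case: k => [m|[|m]]; first by rewrite -PoszD addn1 /= expgSr.
  by rewrite /= mulVg.
have -> : (Negz m.+1 + 1 = Negz m)%R.
  by rewrite NegzE -[m.+2]addn1 PoszD opprD addrNK NegzE.
by rewrite /= (expgS x m.+1) invgM mulgVK.
Qed.

Lemma expgzB1 (k : int) : expgz x (k - 1)%R = expgz x k * x^-1.
Proof. by rewrite -{2}[k](subrK 1%R) expgzS mulgK. Qed.

Lemma expgzD (j k : int) : expgz x (j + k)%R = expgz x j * expgz x k.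
Proof.
elim/int_rect: k => [|k IHk|k IHk]; first by rewrite addr0 mulg1.
  by rewrite -addn1 PoszD addrA !expgzS IHk mulgA.
by rewrite -addn1 PoszD opprD addrA !expgzB1 IHk mulgA.
Qed.

Lemma expgzN (k : int) : expgz x (- k)%R = (expgz x k)^-1.
Proof. by apply: (@mulIg _ (expgz x k)); rewrite -expgzD addNr mulVg. Qed.

End IntegerPowers.

(** * Evaluation of words and the universal property of a presentation *)

Section WordEvaluation.

Variables (X : choiceType) (H : groupType) (F : X -> H).

Definition weval (w : word X) : H :=
  \prod_(c <- w) (if c.2 then F c.1 else (F c.1)^-1).

Lemma weval_cat u v : weval (u ++ v) = weval u * weval v.
Proof. by rewrite /weval big_cat. Qed.

Lemma weval_nil : weval [::] = 1.
Proof. by rewrite /weval big_nil. Qed.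

Lemma weval_cons x b w :
  weval ((x, b) :: w) = (if b then F x else (F x)^-1) * weval w.
Proof. by rewrite /weval big_cons. Qed.

Variable R : word X -> word X -> Prop.
Hypothesis FR : forall u v, R u v -> weval u = weval v.

Lemma weval_wcong u v : wcong R u v -> weval u = weval v.
Proof.
elim=> // {u v} [u v w _ -> _ -> //|u u' v v' _ eu _ ev|x b].
  by rewrite !weval_cat eu ev.
by rewrite !weval_cons weval_nil; case: b; rewrite /= mulg1 ?mulgV ?mulVg.
Qed.

(** Evaluation is constant on congruence classes, so evaluating a chosen representative is
    multiplicative. *)
Lemma presented_lift :
  {f : {multiplicative presented R -> H} | forall x, f (pgen R x) = F x}.
Proof.
pose f (g : presented R) := weval (repr_word g).
have fE w : f (pi_word R w) = weval w.
  exact/weval_wcong/repr_pi_word.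
have fM : {morph f : x y / x * y}.
  move=> g h; rewrite -[g]repr_wordK -[h]repr_wordK.
  by rewrite [_ * _]pmulE !fE weval_cat.
pose fm := isMultiplicative.Build _ _ f fM.
pose fh : {multiplicative presented R -> H} := HB.pack f fm.
by exists fh => x; rewrite [LHS]fE weval_cons weval_nil mulg1.
Qed.

End WordEvaluation.

(** A [multiplicative] map is built from compatibility with products alone; cancellation in the
    target gives the unit, and then inverses. *)
Lemma multiplicative1 (G H : groupType) (f : {multiplicative G -> H}) : f 1 = 1.
Proof. by apply: (@mulgI _ (f 1)); rewrite -gmulfM !mulg1. Qed.

Lemma multiplicativeV (G H : groupType) (f : {multiplicative G -> H}) x :
  f x^-1 = (f x)^-1.
Proof. by apply/esym/mulg1_eq; rewrite -gmulfM mulgV multiplicative1. Qed.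

(** * Induction and extensionality on generators *)

Section PresentedTheory.

Variables (X : choiceType) (R : word X -> word X -> Prop).

Lemma pi_wordE w : pi_word R w = weval (pgen R) w.
Proof.
elim: w => [|[x b] w IHw]; first by rewrite weval_nil.
rewrite weval_cons -IHw.
by case: b; rewrite ?[(pgen R x)^-1]pinvE [_ * _]pmulE.
Qed.

Lemma presented_rel u v : R u v -> weval (pgen R) u = weval (pgen R) v.
Proof. by move=> uv; rewrite -!pi_wordE; apply/pi_wordP/wcong_rel. Qed.

Lemma presented_ind (S : {pred presented R}) :
  group_closed S -> (forall x, pgen R x \in S) -> forall g, g \in S.
Proof.
move=> clS genS g; rewrite -[g]repr_wordK pi_wordE.
elim: (repr_word g) => [|[x b] w IHw]; first by rewrite weval_nil; case: clS.
rewrite weval_cons; apply: group_closedM => //.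
by case: b => //; apply: group_closedV.
Qed.

(** The elements on which two morphisms agree form a subgroup. *)
Lemma presented_ext (H : groupType) (f g : {multiplicative presented R -> H}) :
  (forall x, f (pgen R x) = g (pgen R x)) -> f =1 g.
Proof.
move=> fg a; apply/eqP; move: a.
apply: (@presented_ind (fun a => f a == g a)) => [|x]; last first.
  by rewrite unfold_in fg.
split=> [|a b]; first by rewrite unfold_in !multiplicative1.
rewrite !unfold_in => /eqP fga /eqP fgb.
by rewrite !gmulfM !multiplicativeV fga fgb.
Qed.

End PresentedTheory.

(** * Semidirect product with the integers *)

Section SemidirectZ.

Variables (K : groupType) (s : int -> {multiplicative K -> K}).
Hypothesis s0 : s 0%R =1 id.
Hypothesis sD : forall j k x, s (j + k)%R x = s j (s k x).

(* The laws of the action are parameters so that the group structure, which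
   depends on them, can be inferred from the type. *)
Definition semidirect of s 0%R =1 id &
  (forall j k x, s (j + k)%R x = s j (s k x)) : Type := (K * int)%type.

Local Notation S := (semidirect s0 sD).

HB.instance Definition _ := Choice.on S.

(** A pair [(x, j)] stands for x t^j, where t^j y t^-j = [s j y]; hence (x t^j)(y t^k) = x (t^j y
    t^-j) t^(j+k). *)
Definition sdmul (g h : S) : S := (g.1 * s g.2 h.1, (g.2 + h.2)%R).
Definition sdone : S := (1, 0%R).
Definition sdinv (g : S) : S := (s (- g.2)%R g.1^-1, (- g.2)%R).

Fact sdmulA : associative sdmul.
Proof.
move=> [x j] [y k] [z l]; congr (_, _); rewrite /= ?addrA //.
by rewrite gmulfM sD mulgA.
Qed.

Fact sdmul1g : left_id sdone sdmul.
Proof. by move=> [x j]; congr (_, _); rewrite /= ?s0 ?mul1g ?add0r. Qed.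

Fact sdmulg1 : right_id sdone sdmul.
Proof.
by move=> [x j]; congr (_, _); rewrite /= ?multiplicative1 ?mulg1 ?addr0.
Qed.

Fact sdmulVg : left_inverse sdone sdinv sdmul.
Proof.
move=> [x j]; congr (_, _); rewrite /= ?addNr //.
by rewrite -gmulfM mulVg multiplicative1.
Qed.

Fact sdmulgV : right_inverse sdone sdinv sdmul.
Proof.
move=> [x j]; congr (_, _); rewrite /= ?addrN //.
by rewrite -sD addrN s0 mulgV.
Qed.

HB.instance Definition _ :=
  isGroup.Build S sdmulA sdmul1g sdmulg1 sdmulVg sdmulgV.

Lemma sdmulE (x y : K) (j k : int) :
  ((x, j) : S) * ((y, k) : S) = (x * s j y, (j + k)%R).
Proof. by []. Qed.

Lemma sdinvE (x : K) (j : int) : ((x, j) : S)^-1 = (s (- j)%R x^-1, (- j)%R).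
Proof. by []. Qed.

End SemidirectZ.

(** * Membership in the commutator subgroup *)

Section CommutatorSubgroupTheory.

Variable G : groupType.

Local Notation G' := (commutator_pred G).

Lemma mem_commg (x y : G) : [~ x, y] \in G'.
Proof. by apply/asboolP => S _; apply. Qed.

Lemma mem_commutatorM (x y : G) : x \in G' -> y \in G' -> x * y \in G'.
Proof. exact: (group_closedM (commutator_pred_closed G)). Qed.

(** This is [x ^ y = x * [~ x, y]]. *)
Lemma mem_commutatorJ (x y : G) : x \in G' -> x ^ y \in G'.
Proof.
by move=> Gx; rewrite -[x ^ y](mulVKg x) mem_commutatorM ?mem_commg.
Qed.

(** Here y = u x u^-1, so y x^-1 is a commutator. Braid and pentagon relations have the form u x = y
    u. *)
Lemma mem_commutator_conj (u x y : G) : u * x = y * u -> y * x^-1 \in G'.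
Proof.
move=> e; have -> : y * x^-1 = [~ u^-1, x^-1]; last exact: mem_commg.
by rewrite commgEl conjgE !invgK !mulgA e mulgK.
Qed.

Lemma commutator_valM (x y : commutator_group G) : val (x * y) = val x * val y.
Proof. exact: valM. Qed.

Lemma commutator_val1 : val (1 : commutator_group G) = 1.
Proof. exact: val1. Qed.

Lemma commutator_valV (x : commutator_group G) : val x^-1 = (val x)^-1.
Proof.
by apply/esym/mulg1_eq; rewrite -commutator_valM mulgV commutator_val1.
Qed.

End CommutatorSubgroupTheory.

(** * The Artin relations as equations indexed by natural numbers *)

Section ArtinRelations.

Variable n : nat.

Local Notation a := (artin_gen n).

Lemma pgen_artin (i : idx 1 n) : pgen (@artinH_rel n) i = a (val i).
Proof. by rewrite /artin_gen valK. Qed.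

Lemma artin_commute i j : (1 <= i)%N -> (i + 2 <= j)%N -> (j <= n)%N ->
  a i * a j = a j * a i.
Proof.
move=> i1 ij jn.
have hi : (1 <= i <= n)%N.
  by rewrite i1 (leq_trans _ jn) // (leq_trans _ ij) ?leq_addr.
have hj : (1 <= j <= n)%N by rewrite jn (leq_trans _ ij) ?addn2.
have := presented_rel (@artinH_commute n (exist _ i hi) (exist _ j hj) _).
rewrite /= ij !weval_cons !weval_nil !mulg1 !pgen_artin; exact.
Qed.

Lemma artin_penta : (2 <= n)%N ->
  a 1 * a 2 * a 1 * a 2 * a 1 = a 2 * a 1 * a 2 * a 1 * a 2.
Proof.
move=> n2; have h1 : (1 <= 1 <= n)%N by rewrite (leq_trans _ n2).
have := presented_rel
  (@artinH_penta n (exist _ 1%N h1) (exist _ 2%N n2) erefl erefl).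
by rewrite !weval_cons !weval_nil !mulg1 !pgen_artin !mulgA.
Qed.

Lemma artin_braid i : (2 <= i < n)%N ->
  a i * a i.+1 * a i = a i.+1 * a i * a i.+1.
Proof.
case/andP=> i2 iltn.
have hi : (1 <= i <= n)%N by rewrite (ltnW iltn) (leq_trans _ i2).
have hj : (1 <= i.+1 <= n)%N by [].
have := presented_rel
  (@artinH_braid n (exist _ i hi) (exist _ i.+1 hj) i2 erefl).
by rewrite !weval_cons !weval_nil !mulg1 !pgen_artin !mulgA.
Qed.

End ArtinRelations.

(** * The relations of the presented group K *)

Section PqRelations.

Variable n : nat.

Definition pq_p (k : int) : pq_group n := pgen (@pq_rel n) (p_gen n k).

(* The generator q_l, with the junk value 1 unless 3 <= l <= n. *)
Definition pq_q (l : nat) : pq_group n :=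
  if insub l is Some j then pgen (@pq_rel n) (q_gen j) else 1.

Lemma pgen_q (l : idx 3 n) : pgen (@pq_rel n) (q_gen l) = pq_q (val l).
Proof. by rewrite /pq_q valK. Qed.

Lemma pq_shift k j : (4 <= j <= n)%N ->
  pq_p k * pq_q j = pq_q j * pq_p (k + 1)%R.
Proof.
case/andP=> j4 jn; have hj : (3 <= j <= n)%N by rewrite jn ltnW.
have := presented_rel (@pq_rel_shift n k (exist _ j hj) j4).
by rewrite !weval_cons !weval_nil !mulg1 !pgen_q.
Qed.

(** The inverse letters ending the relator move to the right, leaving positive words on both
    sides. *)
Lemma pq_penta k : pq_p (k + 1)%R * pq_p (k + 3)%R =
  pq_p k * pq_p (k + 2)%R * pq_p (k + 4)%R.
Proof.
have := presented_rel (@pq_rel_penta n k).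
rewrite !weval_cons !weval_nil !mulg1 -!invgM !mulgA.
exact: divg1_eq.
Qed.

Lemma pq_q3 k : (3 <= n)%N ->
  pq_p k * pq_q 3 * pq_p (k + 2)%R = pq_q 3 * pq_p (k + 1)%R * pq_q 3.
Proof.
move=> n3.
have := presented_rel (@pq_rel_q3 n k (exist _ 3%N n3) erefl).
rewrite !weval_cons !weval_nil !mulg1 -!invgM !pgen_q !mulgA.
exact: divg1_eq.
Qed.

Lemma pq_braid i : (3 <= i < n)%N ->
  pq_q i * pq_q i.+1 * pq_q i = pq_q i.+1 * pq_q i * pq_q i.+1.
Proof.
case/andP=> i3 iltn; have hi : (3 <= i <= n)%N by rewrite i3 ltnW.
have hj : (3 <= i.+1 <= n)%N by rewrite iltn (leq_trans i3).
have := presented_rel (@pq_rel_braid n (exist _ i hi) (exist _ i.+1 hj) erefl).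
by rewrite !weval_cons !weval_nil !mulg1 !pgen_q !mulgA.
Qed.

(** * The shift action of the integers on K *)

Definition shift_gen (m : int) (x : pqgen n) : pq_group n :=
  match x with
  | inl k => pq_p (k + m)%R
  | inr l => pgen (@pq_rel n) (q_gen l)
  end.

(** Each family of relations involving p runs over all integers [k], so the shift sends the relation
    at [k] to the one at [k + m]; the braid relation of the q is fixed. *)
Lemma shift_gen_rel m u v : pq_rel u v ->
  weval (shift_gen m) u = weval (shift_gen m) v.
Proof.
case=> [k j j4|k|k l l3|i j ij];
  rewrite !weval_cons !weval_nil !mulg1 /= ?pgen_q ?(addrAC k _ m).
- by apply: pq_shift; rewrite j4; case/andP: (valP j).
- by rewrite -!invgM !mulgA pq_penta mulgV.
- rewrite l3 -!invgM !mulgA pq_q3 ?mulgV //.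
  by case/andP: (valP l) => _; rewrite l3.
rewrite ij !mulgA; apply: pq_braid.
by case/andP: (valP i) => -> _; case/andP: (valP j); rewrite ij.
Qed.

(** The abstract counterpart of x |-> t^m x t^-m: it moves the index of p_k and fixes each q_l, as t
    commutes with a_l for l >= 3. *)
Definition shift (m : int) : {multiplicative pq_group n -> pq_group n} :=
  sval (presented_lift (@shift_gen_rel m)).

Lemma shift_p m k : shift m (pq_p k) = pq_p (k + m)%R.
Proof. exact: (svalP (presented_lift (@shift_gen_rel m))). Qed.

Lemma shift_q m l : shift m (pq_q l) = pq_q l.
Proof.
rewrite /pq_q; case: insub => [j|]; last exact: multiplicative1.
exact: (svalP (presented_lift (@shift_gen_rel m))).
Qed.

Lemma shift0 : shift 0%R =1 id.
Proof.
apply: (@presented_ext _ _ _ (shift 0%R) idfun) => -[k|l].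
  by rewrite -/(pq_p k) shift_p addr0.
by rewrite pgen_q shift_q.
Qed.

Lemma shiftD j k x : shift (j + k)%R x = shift j (shift k x).
Proof.
move: x; apply: (@presented_ext _ _ _ _ (shift j \o shift k)) => -[m|l].
  by rewrite /= -/(pq_p m) !shift_p addrAC addrA.
by rewrite pgen_q /= !shift_q.
Qed.

End PqRelations.

(** * The morphism from the Artin group to the semidirect product *)

Section Isomorphism.

Variable n : nat.
Hypotheses (n3 : (3 <= n)%N) (n4 : (n <= 4)%N).

Local Notation A := (artinH n).
Local Notation A' := (commutator_pred A).
Local Notation K := (pq_group n).
Local Notation a := (artin_gen n).
Local Notation t := (artin_gen n 1).
Local Notation S := (semidirect (shift0 (n := n)) (@shiftD n)).

Definition artin_sd_gen (i : idx 1 n) : S :=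
  (if val i == 1%N then 1 else if val i == 2%N then pq_p n 0%R
   else pq_q n (val i), 1%R).

(** Comparing first components, the pentagon becomes p_1 p_3 = p_0 p_2 p_4, the braid of a_2, a_3
    becomes p_0 q_3 p_2 = q_3 p_1 q_3, and commutation of a_2, a_4 becomes p_0 q_4 = q_4 p_1: the
    relations of K at k = 0. *)
Lemma artin_sd_rel u v : artinH_rel u v ->
  weval artin_sd_gen u = weval artin_sd_gen v.
Proof.
case=> [i j ij|i j i1 j2|i j i2 ij]; rewrite !weval_cons !weval_nil !mulg1 /=.
- wlog {ij} ij : i j / (val i + 2 <= val j)%N.
    by move=> H; case/orP: ij => ij; [|symmetry]; apply: H.
  have j4 : (val j <= 4)%N by apply: leq_trans n4; case/andP: (valP j).
  case/andP: (valP i) => i1 _.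
  rewrite /artin_sd_gen.
  case: (val i =P 1%N) => [ei|/eqP ni1].
    have [nj1 nj2] : (val j == 1%N) = false /\ (val j == 2%N) = false.
      by move: ij; rewrite ei; case: (val j) => [|[|[|m]]].
    by rewrite nj1 nj2 !sdmulE multiplicative1 shift_q mul1g mulg1.
  (* With i different from 1, the bounds i + 2 <= j <= 4 leave only the pair (2, 4). *)
  have i2 : val i = 2%N.
    apply/eqP; rewrite eqn_leq ltn_neqAle eq_sym ni1 i1 andbT.
    by rewrite -(leq_add2r 2) (leq_trans ij).
  have ej : val j = 4%N.
    by apply/eqP; rewrite eqn_leq j4 -[4%N]/(2 + 2)%N -{1}i2.
  rewrite i2 ej !sdmulE shift_q shift_p pq_shift //.
  by case/andP: (valP j); rewrite ej.
- rewrite /artin_sd_gen i1 j2 !sdmulE /= !gmulfM !multiplicative1 !shift_p.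
  by congr (_, _); rewrite !(mul1g, mulg1) !mulgA; apply: (pq_penta n 0%R).
have nj : (val i < n)%N by case/andP: (valP j); rewrite ij.
rewrite /artin_sd_gen ij; move: i2 nj; case: (val i) => [|[|[|m]]] // _ nj.
  rewrite !sdmulE !gmulfM !shift_p !shift_q; congr (_, _); rewrite !mulgA.
  exact: (pq_q3 0%R).
rewrite !sdmulE !gmulfM !shift_q; congr (_, _); rewrite !mulgA.
exact: pq_braid.
Qed.

Definition artin_sd : {multiplicative A -> S} :=
  sval (presented_lift artin_sd_rel).

Lemma artin_sdE i : (1 <= i <= n)%N ->
  artin_sd (a i) = (if i == 1%N then 1 else if i == 2%N then pq_p n 0%R
    else pq_q n i, 1%R).
Proof.
move=> hi; rewrite -(pgen_artin (exist _ i hi)).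
exact: (svalP (presented_lift artin_sd_rel)).
Qed.

(** * Elements of the commutator subgroup *)

Lemma artin_sd_commutator g : g \in A' -> (artin_sd g).2 = 0%R.
Proof.
(* The second component is a morphism to the abelian group of integers, so its kernel is a subgroup
   containing all commutators. *)
move=> /asboolP/(_ (fun g => (artin_sd g).2 == 0%R)) H.
apply/eqP/H => [|x y].
  split=> [|x y]; first by rewrite unfold_in multiplicative1.
  rewrite !unfold_in => /eqP ex /eqP ey.
  by rewrite gmulfM multiplicativeV /= ex ey oppr0 addr0.
rewrite unfold_in !gmulfM !multiplicativeV /=.
by rewrite (addrC (artin_sd x).2) addKr addNr.
Qed.

(** The relation between neighbours reads u a_i = a_(i+1) u, with u = a_1 a_2 a_1 a_2 for i = 1 and
    u = a_i a_(i+1) for i >= 2. *)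
Lemma artin_div_commutator i : (1 <= i < n)%N -> a i.+1 * (a i)^-1 \in A'.
Proof.
case: i => // -[|i] hi.
  apply: (@mem_commutator_conj _ (a 1 * a 2 * a 1 * a 2)).
  by rewrite artin_penta ?(ltnW n3) // !mulgA.
apply: (@mem_commutator_conj _ (a i.+2 * a i.+3)).
by rewrite artin_braid // !mulgA.
Qed.

(** Telescoping: a_l a_1^-1 is the product of the quotients of neighbours. Starting at l = 1 also
    covers [q_elt n 2], which is p_0. *)
Lemma q_elt_commutator l : (1 <= l <= n)%N -> q_elt n l \in A'.
Proof.
elim: l => // -[|l] IHl hl.
  by rewrite /q_elt mulgV; case: (commutator_pred_closed A).
rewrite /q_elt -[a l.+2](mulgVK (a l.+1)) -mulgA mem_commutatorM ?IHl //.
  exact: artin_div_commutator.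
exact: ltnW.
Qed.

(** Since [x ^ y] is y^-1 x y, the exponent [- k] gives conjugation t^k x t^-k. This reduces every
    relation to k = 0. *)
Lemma p_eltD (k m : int) : p_elt n (k + m)%R = p_elt n m ^ (expgz t (- k)%R).
Proof.
rewrite /p_elt conjgE !expgzN invgK !mulgA -expgzD -!mulgA.
by rewrite -[(k + m + 1)%R]addrA (expgzD _ k (m + 1)%R) invgM.
Qed.

Lemma p_elt0 : p_elt n 0%R = a 2 * t^-1.
Proof. by rewrite /p_elt mul1g. Qed.

Lemma p_eltE k : p_elt n k = q_elt n 2 ^ (expgz t (- k)%R).
Proof. by rewrite -{1}[k]addr0 p_eltD p_elt0. Qed.

Lemma p_elt_commutator k : p_elt n k \in A'.
Proof. by rewrite p_eltE mem_commutatorJ ?q_elt_commutator ?(ltnW n3). Qed.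

Lemma q_eltJ l k : (3 <= l <= n)%N -> q_elt n l ^ (expgz t k) = q_elt n l.
Proof.
case/andP=> l3 ln; have ct : commute t (q_elt n l).
  apply: commuteM; first by apply: artin_commute.
  exact/commuteV/commute_refl.
have : commute (q_elt n l) (expgz t k).
  case: k => m; first exact/commuteX/commute_sym.
  exact/commuteV/commuteX/commute_sym.
by move=> c; rewrite conjgE c mulKg.
Qed.

(** * The relations of K hold in the Artin group *)

Lemma p_elt_nat (m : nat) : p_elt n m = t ^+ m * a 2 * (t ^+ m.+1)^-1.
Proof. by rewrite /p_elt expgzN -PoszD addn1. Qed.

(** At k = 0 the inner powers of t cancel, leaving t a_2 t a_2 t^-4 and a_2 t a_2 t a_2 t^-5, equal
    by the pentagon relation. *)
Lemma p_elt_penta k : p_elt n (k + 1)%R * p_elt n (k + 3)%R =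
  p_elt n k * p_elt n (k + 2)%R * p_elt n (k + 4)%R.
Proof.
rewrite -{3}[k]addr0 !(p_eltD k) -!conjMg; congr (_ ^ _).
rewrite (p_elt_nat 0) (p_elt_nat 1) (p_elt_nat 2) (p_elt_nat 3) (p_elt_nat 4).
rewrite !expgSr expg0 !mul1g !invgM !mulgA.
rewrite !mulgVK.
by rewrite -artin_penta ?mulgK // ltnW.
Qed.

(** A rewrite rule for left-associated products that collects the factors t^-1 to the right of
    a_l. *)
Lemma artin_mulVC l g : (3 <= l <= n)%N -> g * t^-1 * a l = g * a l * t^-1.
Proof.
case/andP=> l3 ln; rewrite -!mulgA; congr (_ * _).
exact/commute_sym/commuteV/commute_sym/artin_commute.
Qed.

(** At k = 0 the two sides are a_2 a_3 a_2 t^-3 and a_3 a_2 a_3 t^-3. *)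
Lemma p_elt_q3 k : p_elt n k * q_elt n 3 * p_elt n (k + 2)%R =
  q_elt n 3 * p_elt n (k + 1)%R * q_elt n 3.
Proof.
rewrite -{1}[k]addr0 !(p_eltD k) -(@q_eltJ 3 (- k)%R) // -!conjMg.
congr (_ ^ _); rewrite (p_elt_nat 0) (p_elt_nat 1) (p_elt_nat 2) /q_elt.
rewrite !expgSr expg0 !mul1g !invgM !mulgA.
by rewrite !mulgVK !(@artin_mulVC 3) // !mulgVK artin_braid.
Qed.

(** At k = 0 the two sides are a_2 a_4 t^-2 and a_4 a_2 t^-2. *)
Lemma p_elt_shift k : (4 <= n)%N ->
  p_elt n k * q_elt n 4 = q_elt n 4 * p_elt n (k + 1)%R.
Proof.
move=> hn4.
rewrite -{1}[k]addr0 !(p_eltD k) -(@q_eltJ 4 (- k)%R) ?hn4 // -!conjMg.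
congr (_ ^ _); rewrite (p_elt_nat 0) (p_elt_nat 1) /q_elt.
rewrite !expgSr expg0 !mul1g !invgM !mulgA.
rewrite !mulgVK.
by rewrite !(@artin_mulVC 4) ?hn4 // artin_commute.
Qed.

Lemma q_elt_braid : (4 <= n)%N ->
  q_elt n 3 * q_elt n 4 * q_elt n 3 = q_elt n 4 * q_elt n 3 * q_elt n 4.
Proof.
move=> hn4; rewrite /q_elt !mulgA.
by rewrite !(@artin_mulVC 3, @artin_mulVC 4) ?hn4 // artin_braid.
Qed.

(** * The morphism from K to the commutator subgroup *)

Definition pq_artin_gen (x : pqgen n) : commutator_group A :=
  match x with
  | inl k => CommutatorGroup (p_elt_commutator k)
  | inr l => insubd 1 (q_elt n (val l))
  end.

Lemma val_pq_artin_gen_p k : val (pq_artin_gen (inl k)) = p_elt n k.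
Proof. by []. Qed.

(** The default [1] of [insubd] is never taken, because these elements lie in the commutator
    subgroup. *)
Lemma val_pq_artin_gen_q l : val (pq_artin_gen (inr l)) = q_elt n (val l).
Proof.
rewrite insubdK //; apply: q_elt_commutator.
by case/andP: (valP l) => l3 ->; rewrite (leq_trans _ l3).
Qed.

Lemma pq_artin_rel u v : pq_rel u v ->
  weval pq_artin_gen u = weval pq_artin_gen v.
Proof.
case=> [k j j4|k|k l l3|i j ij]; apply: val_inj;
  rewrite !weval_cons !weval_nil !mulg1 !commutator_valM ?commutator_valV;
  rewrite ?commutator_val1 ?val_pq_artin_gen_q ?val_pq_artin_gen_p.
- have [j_gt jn] := andP (valP j).
  have ej : val j = 4%N by apply/eqP; rewrite eqn_leq j4 (leq_trans jn).
  by rewrite ej p_elt_shift // -ej.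
- by rewrite -!invgM mulgA p_elt_penta mulgV.
- by rewrite l3 -!invgM 2!mulgA p_elt_q3 mulgV.
have [i_gt _] := andP (valP i); have [_ jn] := andP (valP j).
(* As i >= 3 and i + 1 <= 4, the only braid relation in K is that of q_3 and q_4. *)
have ei : val i = 3%N.
  by apply/eqP; rewrite eqn_leq i_gt andbT -ltnS -ij (leq_trans jn).
rewrite ij in jn *; rewrite ei in jn *.
rewrite (mulgA (q_elt n 3)) (mulgA (q_elt n 4)).
exact: q_elt_braid.
Qed.

Definition pq_artin : {multiplicative K -> commutator_group A} :=
  sval (presented_lift pq_artin_rel).

Lemma pq_artin_p k : val (pq_artin (pq_p n k)) = p_elt n k.
Proof. by rewrite [pq_artin _](svalP (presented_lift pq_artin_rel)). Qed.

Lemma pq_artin_q l : (3 <= l <= n)%N -> val (pq_artin (pq_q n l)) = q_elt n l.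
Proof.
move=> hl; rewrite -(pgen_q (exist _ l hl)).
by rewrite [pq_artin _](svalP (presented_lift pq_artin_rel)) val_pq_artin_gen_q.
Qed.

(** * The two maps are mutually inverse *)

Lemma artin_sd_expgz k : artin_sd (expgz t k) = (1, k).
Proof.
have t1 : artin_sd t = (1, 1%R) by rewrite artin_sdE // (leq_trans _ n3).
elim/int_rect: k => [|k IHk|k IHk]; first exact: multiplicative1.
  rewrite -[k.+1]addn1 PoszD expgzS gmulfM IHk t1 sdmulE multiplicative1 mulg1.
  by [].
rewrite -[k.+1]addn1 PoszD opprD expgzB1 gmulfM IHk multiplicativeV t1.
by rewrite sdinvE sdmulE invg1 !multiplicative1 mulg1.
Qed.

(** Pairs with second component 0 multiply as in K, so the claim defines a subgroup and is checked
    on generators. *)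
Lemma artin_sdK x : artin_sd (val (pq_artin x)) = (x, 0%R).
Proof.
apply/eqP; move: x.
apply: (@presented_ind _ _ (fun x => artin_sd (val (pq_artin x)) == (x, 0%R))).
  split=> [|x y]; first by rewrite unfold_in !multiplicative1.
  rewrite !unfold_in => /eqP ex /eqP ey.
  rewrite gmulfM commutator_valM gmulfM.
  rewrite multiplicativeV commutator_valV multiplicativeV ex ey.
  by rewrite sdinvE sdmulE oppr0 addr0 !shift0.
case=> [k|l]; rewrite unfold_in.
  have h1 : (1 <= 1 <= n)%N by rewrite (leq_trans _ n3).
  have h2 : (1 <= 2 <= n)%N by apply: ltnW.
  (* Writing p_k = t^k p_0 t^-k, the image is the conjugate of (p_0, 0) by (1, k), whose first
     component is [shift n k] applied to p_0. *)
  rewrite -/(pq_p n k) pq_artin_p p_eltE /q_elt conjgE expgzN invgK.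
  rewrite !gmulfM !multiplicativeV artin_sd_expgz !artin_sdE //.
  rewrite !sdinvE !sdmulE !(invg1, multiplicative1, mulg1, mul1g) shift_p.
  by rewrite add0r subrr add0r subrr.
have hl := valP l; have [l3 ln] := andP hl.
rewrite pgen_q pq_artin_q // /q_elt gmulfM multiplicativeV !artin_sdE //.
- rewrite sdinvE sdmulE invg1 !multiplicative1 mulg1 subrr.
  by move: l3; case: (val l) => [|[|[|m]]].
- by rewrite (leq_trans _ n3).
by rewrite ln (leq_trans _ l3).
Qed.

(** Equivariance: the shift on K corresponds to conjugation by t^m, which makes (x, m) |-> x t^m
    multiplicative. *)
Lemma pq_artin_shift m x :
  val (pq_artin (shift n m x)) = val (pq_artin x) ^ (expgz t (- m)%R).
Proof.
apply/eqP; move: x.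
apply: (@presented_ind _ _ (fun x => val (pq_artin (shift n m x)) ==
  val (pq_artin x) ^ (expgz t (- m)%R))).
  split=> [|x y].
    by rewrite unfold_in !(multiplicative1, commutator_val1) conj1g.
  rewrite !unfold_in => /eqP ex /eqP ey.
  rewrite (@gmulfM _ _ (shift n m)) !(@gmulfM _ _ pq_artin) !commutator_valM.
  rewrite (multiplicativeV (shift n m)) !(multiplicativeV pq_artin).
  rewrite !commutator_valV ex ey.
  by rewrite conjMg conjVg.
case=> [k|l]; rewrite unfold_in.
  by rewrite -/(pq_p n k) shift_p !pq_artin_p addrC p_eltD.
have hl := valP l.
by rewrite pgen_q shift_q pq_artin_q // q_eltJ.
Qed.

Lemma artin_sdVK g :
  g = val (pq_artin (artin_sd g).1) * expgz t (artin_sd g).2.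
Proof.
(* Being a morphism, [psi] composed with [artin_sd] need only be compared with the identity on the
   a_i, where it returns (a_i t^-1) t. *)
pose psi (h : S) : A := val (pq_artin h.1) * expgz t h.2.
have psiM h k : psi (h * k) = psi h * psi k.
  rewrite /psi /= gmulfM commutator_valM pq_artin_shift conjgE !expgzN invgK.
  by rewrite expgzD !mulgA mulgVK.
pose f := isMultiplicative.Build _ _ psi psiM.
pose psih : {multiplicative S -> A} := HB.pack psi f.
move: g; apply: (@presented_ext _ _ _ idfun (psih \o artin_sd)) => i.
have hi := valP i; have [i1 _] := andP hi.
rewrite pgen_artin /= artin_sdE // /psi /=.
case: eqVneq => [->|ni1]; first
  by rewrite multiplicative1 commutator_val1 mul1g.
case: eqVneq => [->|ni2]; first by rewrite pq_artin_p p_elt0 mulgVK.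
rewrite pq_artin_q ?mulgVK //; case/andP: hi => _ ->; rewrite andbT.
by move: i1 ni1 ni2 => /=; case: (sval i) => [|[|[|m]]].
Qed.

(** The inverse takes the first component of [artin_sd]; on the commutator subgroup the power of t
    in [artin_sdVK] is trivial. *)
Lemma pq_artin_bij : bijective pq_artin.
Proof.
exists (fun g => (artin_sd (val g)).1) => [x|g]; first by rewrite artin_sdK.
apply: val_inj; rewrite [RHS]artin_sdVK artin_sd_commutator ?mulg1 //.
exact: valP.
Qed.

End Isomorphism.

Theorem theorem3p16 (n : nat) (hn : n = 3 \/ n = 4) :
  (forall k : int, p_elt n k \in commutator_pred (artinH n)) /\
  (forall l : idx 3 n, q_elt n (val l) \in commutator_pred (artinH n)) /\
  (exists f : {multiplicative pq_group n -> commutator_group (artinH n)},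
    (forall k : int, val (f (pgen (@pq_rel n) (p_gen n k))) = p_elt n k) /\
    (forall l : idx 3 n,
      val (f (pgen (@pq_rel n) (q_gen l))) = q_elt n (val l)) /\
    bijective f).
Proof.
have n3 : (3 <= n)%N by case: hn => ->.
have n4 : (n <= 4)%N by case: hn => ->.
split; first exact: p_elt_commutator.
split.
  move=> l; apply: q_elt_commutator => //.
  by case/andP: (valP l) => l3 ->; rewrite (leq_trans _ l3).
exists (pq_artin n3 n4); split; first exact: pq_artin_p.
split; last exact: pq_artin_bij.
by move=> l; rewrite pgen_q pq_artin_q //; exact: (valP l).
Qed.
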